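(* Let $n,k$ be positive integers with $k\le 3^n$. Then: if $n\ge 3$, $v_3(s(3^n,k))\le v_3(s(3^n,1))=\frac12(3^n-2n-1)$; if $n=2$, $v_3(s(3^2,k))\le v_3(s(3^2,6))=4$; if $n=1$, $v_3(s(3,k))\le v_3(s(3,2))=1$.
   Context: $s(N,K)$ denotes the unsigned Stirling number of the first kind (the number of permutations of $N$ elements with exactly $K$ disjoint cycles). For a nonzero integer $x$, $v_3(x)$ is the exponent of the largest power of $3$ dividing $x$. *)

(* Defs.v *)
From mathcomp Require Import all_boot all_fingroup.

Set Implicit Arguments.
Unset Strict Implicit.
Unset Printing Implicit Defensive.

(* [porbits s] contains the singleton orbits, so fixed points count as cycles. *)
Definition stirling1 (N K : nat) : nat :=
  #|[set s : 'S_N | #|porbits s| == K]|.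

(* Main.v *)
(** The Stirling numbers [s(3^n, k)] are the coefficients of
    [P_n(X) = X (X + 1) ... (X + 3^n - 1)].  Tripling the length of a product of
    shifts cubes it modulo one more power of [3], whence
    [P_n = (X^3 - X)^(3^(n-1)) mod 3^n].  Separating the factors [X + i] with
    [3 | i] gives in the same way [P_(n+1)(3 X) = 3^(3^n) P_n(X) W] with
    [W = -1 mod 3^(n+1)].  Iterating, [3^(l k) s(3^(n+l), k)] is, up to sign,
    [3^C (s(3^n, k) + 3^(n+1) y)] with [C = 3^n + ... + 3^(n+l-1)].  For odd [k] between
    [3^m] and [3^(m+1)] the binomial coefficients of [(X^2 - 1)^(3^m)] then give
    [v(s(3^n, k)) <= C - l k + m] where [n = m + 1 + l]; even indices are
    reduced to odd ones by the symmetry [X -> - X - 3^n] of [P_n(X) / X]. *)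

Require Import Defs.
From mathcomp Require Import all_boot all_order all_algebra all_fingroup.
From mathcomp Require Import ring zify.

Set Implicit Arguments.
Unset Strict Implicit.
Unset Printing Implicit Defensive.

Import GRing.Theory.

(** * Stirling numbers as coefficients of the rising factorial *)

Fixpoint stirling1_rec N K :=
  if N is N'.+1 then
    (if K is K'.+1 then stirling1_rec N' K' else 0) + N' * stirling1_rec N' K
  else K == 0 : nat.

Section GeneratingFunction.
Local Open Scope ring_scope.

Definition rising (N : nat) : {poly int} := \prod_(0 <= i < N) ('X + i%:R).

(** Left multiplication by [tperm i j] turns the condition that [j] has preimage [i] into [s j = j],
    so each fibre is reindexed by the permutations supported below [j]. *)
Lemma perm_on_ltS N (j i : 'I_N) (s : 'S_N) : (i <= j)%N ->
  perm_on [set x : 'I_N | (x < j.+1)%N] (tperm i j * s)%g &&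
    ((tperm i j * s)^-1%g j == i)
  = perm_on [set x : 'I_N | (x < j)%N] s.
Proof.
move=> le_ij; have tA: perm_on [set x : 'I_N | (x < j.+1)%N] (tperm i j).
  by apply/subsetP => x; rewrite !inE; case: tpermP => [->|->|]; rewrite ?ltnS ?eqxx.
have -> : ((tperm i j * s)^-1%g j == i) = (s j == j).
  by rewrite (can2_eq (permKV _) (permK _)) permM tpermL eq_sym.
apply/andP/idP => [[tsA /eqP sj]|sA].
  have: perm_on [set x : 'I_N | (x < j.+1)%N] s.
    by rewrite -[s](mulKg (tperm i j)) tpermV; apply: perm_onM.
  move/subsetP=> sA; apply/subsetP => x; rewrite !inE => sx.
  have:= sA x; rewrite !inE ltnS leq_eqVlt => /(_ sx) /orP[/eqP/val_inj xj|//].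
  by move: sx; rewrite xj sj eqxx.
split; last by apply/eqP; rewrite (out_perm sA) // inE ltnn.
apply: perm_onM => //; apply: subset_trans sA _.
by apply/subsetP => x; rewrite !inE => /ltnW.
Qed.

(* A permutation supported on [0, j] is [tperm i j * s] for unique [i <= j] and [s]
   supported on [0, j - 1]; the transposition merges the fixed point [j] of [s] into
   the cycle of [i], unless [i = j]. *)
Lemma sum_perm_on_lt N j : (j <= N)%N ->
  'X^j * (\sum_(s : 'S_N | perm_on [set x : 'I_N | (x < j)%N] s)
            'X^#|porbits s|) = 'X^N * rising j :> {poly int}.
Proof.
elim: j => [|j IH] ltjN.
  rewrite /rising big_nil mulr1 mul1r (big_pred1 1%g).
    congr ('X^_); rewrite -[RHS](card_ord N) /porbits.
    apply: card_imset => x y xy; have: x \in porbit 1 y by rewrite -xy porbit_id.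
    by move=> /porbitP[k ->]; rewrite expg1n perm1.
  move=> s /=; apply/idP/eqP=> [sA|->]; last exact: perm_on1.
  by apply/permP=> x; rewrite perm1 (out_perm sA) // inE.
pose oj := Ordinal ltjN; have {IH} := IH (ltnW ltjN).
rewrite /rising big_nat_recr //= => IH.
pose A := [set x : 'I_N | (x < oj.+1)%N].
rewrite (partition_big (fun s : 'S_N => (s^-1)%g oj) (mem A)) /=; last first.
  move=> s sA; rewrite inE ltnS leqNgt; apply/negP => lt.
  have: s (s^-1%g oj) = s^-1%g oj by apply: (out_perm sA); rewrite inE -leqNgt.
  by rewrite permKV => e; rewrite -e ltnn in lt.
under eq_bigr => i.
  rewrite inE ltnS => leij.
  rewrite (reindex_inj (mulgI (tperm i oj))) /=.
  under eq_bigl => s do rewrite (perm_on_ltS s leij).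
  over.
rewrite exprSr -mulrA mulr_sumr.
have step (i : 'I_N) : (i <= j)%N ->
   'X * (\sum_(s : 'S_N | perm_on [set x : 'I_N | (x < j)%N] s)
            'X^#|porbits (tperm i oj * s)%g|)
   = (if i == oj then 'X else 1) * (\sum_(s : 'S_N | perm_on [set x : 'I_N | (x < j)%N] s)
            'X^#|porbits s|) :> {poly int}.
  move=> leij; rewrite !mulr_sumr; apply: eq_bigr => s sA.
  have sj : s oj = oj by rewrite (out_perm sA) // inE ltnn.
  have := porbits_mul_tperm s i oj.
  have -> : (i \notin porbit s oj) = (i != oj).
    congr (~~ _); apply/idP/eqP => [|->]; last exact: porbit_id.
    by rewrite -porbit_sym porbit_sym => /porbitP[k ->]; rewrite permX; elim: k => //= k ->.
  case: eqP => [->|_] /=; first by rewrite !addn0 => ->.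
  by rewrite mul1r addn1 addn2 => -[<-]; rewrite exprS.
rewrite (eq_bigr (fun i => (if i == oj then 'X else 1) *
   \sum_(s : 'S_N | perm_on [set x : 'I_N | (x < j)%N] s) 'X^#|porbits s|));
  last by move=> i; rewrite inE ltnS => /step.
rewrite -mulr_suml mulrCA IH mulrCA; congr (_ * _); rewrite mulrC; congr (_ * _).
rewrite (bigD1 oj) ?inE //= eqxx (eq_bigr (fun=> 1)) => [|i /andP[_ /negbTE->] //].
rewrite sumr_const; congr (_ + _%:R).
rewrite (eq_card (B := [pred i : 'I_N | (i < j)%N])); last first.
  move=> i; rewrite !inE unfold_in inE ltnS ltn_neqAle andbC.
  by congr (_ && _); rewrite -val_eqE.
rewrite -sum1_card -(big_ord_widen _ (fun=> 1%N)) ?sum_nat_const ?card_ord ?muln1 //.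
exact: ltnW.
Qed.

Lemma stirling1_coef N k : (stirling1 N k)%:R = (rising N)`_k :> int.
Proof.
have := sum_perm_on_lt (leqnn N).
rewrite (eq_bigl predT) => [/mulfI<-|s]; first last.
- by apply/subsetP => x; rewrite inE ltn_ord.
- by rewrite -size_poly_eq0 size_polyXn.
rewrite coef_sum /stirling1 -sum1_card natr_sum.
rewrite [RHS](bigID (mem [set s : 'S_N | #|porbits s| == k])) /=.
rewrite [X in _ + X]big1 ?addr0 => [|s]; last by rewrite inE coefXn eq_sym => /negbTE ->.
by apply: eq_bigr => s; rewrite inE coefXn => /eqP ->; rewrite eqxx.
Qed.

(** Makes the exceptional values [s(9, 6)] and [s(3, 2)] computable. *)
Lemma stirling1E N K : stirling1 N K = stirling1_rec N K.
Proof.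
suff: (stirling1 N K)%:R = (stirling1_rec N K)%:R :> int.
  by move/eqP; rewrite Num.Theory.eqr_nat => /eqP.
rewrite stirling1_coef.
elim: N K => [|N IH] K; first by rewrite /rising big_nil coef1.
rewrite /rising big_nat_recr //= mulrDr coefD coefMX mulr_natr coefMn !IH.
by rewrite natrD natrM mulr_natl; case: K.
Qed.

End GeneratingFunction.

(** * Congruences modulo powers of 3 *)

Section Congruences.
Local Open Scope ring_scope.
Variable R : comNzRingType.
Implicit Types a b c d : R.

Definition eqmod d a b := exists c, a = b + d * c.

Lemma eqmod_refl d a : eqmod d a a.
Proof. by exists 0; rewrite mulr0 addr0. Qed.

Lemma eqmod_trans b d a c : eqmod d a b -> eqmod d b c -> eqmod d a c.
Proof. by case=> x -> [y ->]; exists (x + y); ring. Qed.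

Lemma eqmodM d a a' b b' : eqmod d a a' -> eqmod d b b' ->
  eqmod d (a * b) (a' * b').
Proof. by case=> x -> [y ->]; exists (x * b' + a' * y + d * x * y); ring. Qed.

Lemma eqmod_dvd d e a b : eqmod (d * e) a b -> eqmod d a b.
Proof. by case=> x ->; exists (e * x); rewrite mulrA. Qed.

(** With [d = 3^(n+1)], the terms [3 b^2 d x], [3 b d^2 x^2] and [d^3 x^3] of the expanded cube are
    all multiples of [3 d]. *)
Lemma eqmod_cube n a b : eqmod (3 ^+ n.+1) a b -> eqmod (3 ^+ n.+2) (a ^+ 3) (b ^+ 3).
Proof.
case=> x ->; exists (b ^+ 2 * x + 3 ^+ n.+1 * b * x ^+ 2 + 3 ^+ n * 3 ^+ n.+1 * x ^+ 3).
rewrite !exprS; ring.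
Qed.

Lemma eqmod_exp3 n a b : eqmod 3 a b -> eqmod (3 ^+ n.+1) (a ^+ (3 ^ n)) (b ^+ (3 ^ n)).
Proof.
move=> ab; elim: n => [|n IH]; first by rewrite expr1.
by rewrite expnSr !exprM; apply: eqmod_cube.
Qed.

End Congruences.

(** * Products of shifts by multiples of 3 *)

Section Shift.
Local Open Scope ring_scope.
Variable R : comNzRingType.
Implicit Types p q f g : {poly R}.

Lemma eqmod_comp (n : nat) p q r : eqmod (3 ^+ n) p q -> eqmod (3 ^+ n) (p \Po r) (q \Po r).
Proof.
case=> c ->; exists (c \Po r); rewrite comp_polyD comp_polyM.
by rewrite (rmorphXn (comp_poly r)) rmorph_nat.
Qed.

Lemma taylor1 p c : exists q, p \Po ('X + c) = p + c * p^`() + c ^+ 2 * q.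
Proof.
elim/poly_ind: p => [|p a [q IH]].
  by exists 0; rewrite comp_poly0 deriv0 !mulr0 !addr0.
rewrite derivD derivM derivC derivX comp_polyD comp_polyM comp_polyC comp_polyX IH.
by exists (p^`() + 'X * q + c * q); ring.
Qed.

(** Taking [f = X (X + 1) (X + 2)] gives [rising (3 ^ n.+1)]; taking [f = X] keeps only its factors
    [X + i] with [3 | i]. *)
Definition shiftprod f (n : nat) : {poly R} :=
  \prod_(0 <= b < 3 ^ n) (f \Po ('X + (b * 3)%:R)).

Lemma shiftprodS f n : shiftprod f n.+1 =
  shiftprod f n * (shiftprod f n \Po ('X + (3 ^ n.+1)%:R))
  * (shiftprod f n \Po ('X + (3 ^ n.+1)%:R *+ 2)).
Proof.
rewrite /shiftprod; set d := (3 ^ n.+1)%:R.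
rewrite !rmorph_prod /= expnS !mulSn mul0n addn0.
rewrite (big_cat_nat (n := 3 ^ n)) ?leq_addr //=.
rewrite (big_cat_nat (m := 3 ^ n) (n := 3 ^ n + 3 ^ n)) ?leq_addr ?leq_add2l ?leq_addr //=.
rewrite mulrA; congr (_ * _ * _).
  rewrite -{1}[(3 ^ n)%N]add0n big_addn addnK; apply: eq_bigr => b _.
  rewrite -comp_polyA comp_polyD comp_polyX (rmorph_nat (comp_poly _)); congr (f \Po _).
  by rewrite mulnDl natrD -expnSr -/d addrA addrAC.
rewrite -{1}[(3 ^ n + 3 ^ n)%N]add0n big_addn addnK; apply: eq_bigr => b _.
rewrite -comp_polyA comp_polyD comp_polyX (rmorph_nat (comp_poly _)); congr (f \Po _).
by rewrite !mulnDl !natrD -expnSr -/d; ring.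
Qed.

(* The three shifts contribute derivative terms with total weight [0 + 1 + 2 = 3],
   which gains one more factor of [3]. *)
Lemma shiftprod_eqmod f n : eqmod (3 ^+ n.+1) (shiftprod f n) (f ^+ (3 ^ n)).
Proof.
elim: n => [|n IH].
  by rewrite /shiftprod big_nat1 mul0n addr0 comp_polyXr expr1; apply: eqmod_refl.
rewrite expnSr exprM; apply: (eqmod_trans _ (eqmod_cube IH)).
rewrite shiftprodS; set A := shiftprod f n.
have [r1 ->] := taylor1 A (3 ^ n.+1)%:R.
have [r2 ->] := taylor1 A ((3 ^ n.+1)%:R *+ 2).
set A' := A^`(); rewrite natrX !exprS; set t := 3 ^+ n.
exists (A ^+ 2 * A' + t * (2 * A * A' ^+ 2 + A ^+ 2 * r1 + 4 * A ^+ 2 * r2)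
  + t * (t * 3) * (4 * A * A' * r2 + 2 * A * A' * r1 + 4 * t * 3 * A * r1 * r2)).
ring.
Qed.

End Shift.

(** * Congruence and scaling of the rising factorial *)

Section RisingFactorial.
Local Open Scope ring_scope.

Lemma shiftprodM (R : comNzRingType) (f g : {poly R}) n :
  shiftprod (f * g) n = shiftprod f n * shiftprod g n.
Proof. by rewrite -big_split /=; apply: eq_bigr => b _; rewrite comp_polyM. Qed.

Lemma comp_polyXDn (R : comNzRingType) n (q : {poly R}) :
  ('X + n%:R) \Po q = q + n%:R.
Proof. by rewrite comp_polyD comp_polyX -polyC_natr comp_polyC. Qed.

Lemma rising_shiftprod n :
  rising (3 ^ n.+1) = shiftprod ('X * (('X + 1%:R) * ('X + 2))) n.
Proof.
rewrite /rising expnSr big_nat_mul; apply: eq_bigr => b _.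
rewrite mulSn addnC /index_iota addKn /= !big_cons big_nil mulr1.
rewrite !comp_polyM !comp_polyXDn comp_polyX.
by rewrite -!addrA -!natrD addn1 addn2.
Qed.

Lemma rising_eqmod n :
  eqmod (3 ^+ n.+1) (rising (3 ^ n.+1)) (('X^3 - 'X) ^+ (3 ^ n)).
Proof.
rewrite rising_shiftprod; apply: (eqmod_trans (shiftprod_eqmod _ _)).
(* Indeed [X (X + 1) (X + 2) = X^3 - X + 3 (X^2 + X)]. *)
by apply: eqmod_exp3; exists ('X ^+ 2 + 'X); ring.
Qed.

(** Under [X -> 3 X] a factor [X + 3 b] becomes [3 (X + b)]. The other factors form [W]: [(3 X + 1)
    (3 X + 2) = -1 + 3 (3 X^2 + 3 X + 1)], and the odd exponent [3^n] preserves [-1]. *)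
Lemma rising_scale n : exists2 W,
  rising (3 ^ n.+1) \Po (3 * 'X) = 3 ^+ (3 ^ n) * rising (3 ^ n) * W
  & eqmod (3 ^+ n.+1) W (-1).
Proof.
rewrite rising_shiftprod shiftprodM comp_polyM.
exists (shiftprod (('X + 1%:R) * ('X + 2)) n \Po (3 * 'X)).
  congr (_ * _); rewrite /shiftprod /rising rmorph_prod /=.
  rewrite -[X in 3 ^+ X]subn0 -prodr_const_nat -big_split /=.
  apply: eq_bigr => b _; rewrite comp_polyX comp_polyXDn.
  by rewrite natrM; ring.
apply: eqmod_trans (eqmod_comp _ (shiftprod_eqmod _ _)) _.
rewrite (rmorphXn (comp_poly _)) /= comp_polyM !comp_polyXDn.
have -> : -1 = (-1) ^+ (3 ^ n) :> {poly int}.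
  by rewrite -signr_odd oddX orbT.
by apply: eqmod_exp3; exists (3 * 'X ^+ 2 + 3 * 'X + 1); ring.
Qed.

Lemma rising_scale_iter n l : exists2 W,
  rising (3 ^ (n + l)) \Po (3 ^+ l * 'X)
    = 3 ^+ (\sum_(i < l) 3 ^ (n + i)) * rising (3 ^ n) * W
  & eqmod (3 ^+ n.+1) W ((-1) ^+ l).
Proof.
elim: l => [|l [W eW cW]].
  exists 1; last exact: eqmod_refl.
  by rewrite big_ord0 addn0 !mul1r mulr1 comp_polyXr.
have [V eV cV] := rising_scale (n + l).
exists (W * (V \Po (3 ^+ l * 'X))); last first.
  rewrite [(-1) ^+ l.+1]exprSr; apply: eqmodM => //.
  have -> : -1 = -1 \Po (3 ^+ l * 'X) :> {poly int}.
    by rewrite (rmorphN1 (comp_poly _)).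
  (* Level [n + l] provides the finer modulus [3^(n+l+1)], weakened here to [3^(n+1)]. *)
  apply: eqmod_comp; move: cV; rewrite -addSn exprD; exact: eqmod_dvd.
have -> : 3 ^+ l.+1 * 'X = (3 * 'X) \Po (3 ^+ l * 'X) :> {poly int}.
  by rewrite comp_polyM comp_polyX (rmorph_nat (comp_poly _)) exprS mulrA.
rewrite addnS comp_polyA eV !comp_polyM eW big_ord_recr exprD /=.
by rewrite (rmorphXn (comp_poly _)) (rmorph_nat (comp_poly _)); ring.
Qed.

Lemma coef_exp3M (R : comNzRingType) e (p : {poly R}) k : (3 ^+ e * p)`_k = 3 ^+ e * p`_k.
Proof. by rewrite -!natrX !mulr_natl coefMn. Qed.

Lemma coef_comp_scale (R : comNzRingType) l (p : {poly R}) k :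
  (p \Po (3 ^+ l * 'X))`_k = 3 ^+ (l * k) * p`_k.
Proof.
elim/poly_ind: p k => [|p c IH] k; first by rewrite comp_poly0 coef0 mulr0.
rewrite comp_polyD comp_polyM comp_polyX comp_polyC mulrCA coefD coef_exp3M.
rewrite coefMX coefD coefMX !coefC; case: k => [|k] /=; first by rewrite muln0 mulr0 mul1r.
by rewrite IH mulnS exprD !addr0 mulrA.
Qed.

Lemma coef_rising_scale n l k : exists y : int,
  3 ^+ (l * k) * (rising (3 ^ (n + l)))`_k =
  3 ^+ (\sum_(i < l) 3 ^ (n + i)) * ((-1) ^+ l * (rising (3 ^ n))`_k + 3 ^+ n.+1 * y).
Proof.
have [W eW [V eV]] := rising_scale_iter n l.
exists (rising (3 ^ n) * V)`_k.
rewrite -coef_comp_scale eW -mulrA coef_exp3M; congr (_ * _).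
rewrite eV mulrDr coefD mulrCA coef_exp3M -(signr_odd {poly int}).
rewrite -(signr_odd int); congr (_ + _).
by case: odd; rewrite ?(mulrN1, mulN1r, coefN, mulr1, mul1r).
Qed.

Lemma sum_exp3 n l : ((\sum_(i < l) 3 ^ (n + i)).*2 + 3 ^ n = 3 ^ (n + l))%N.
Proof.
elim: l => [|l IH]; first by rewrite big_ord0 addn0.
rewrite big_ord_recr /= doubleD addnAC IH addnS expnS; lia.
Qed.

End RisingFactorial.

(** * Valuations of the coefficients *)

Section Valuations.

(** By Pascal's rule two neighbours in row [p^m - 1] add up to an inner entry of row [p^m], a
    multiple of [p]; so non-divisibility propagates from the entry 1. *)
Lemma prime_ndvd_bin_pred p m i : prime p -> i < p ^ m -> ~~ (p %| 'C((p ^ m).-1, i)).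
Proof.
move=> pr_p; have pm_gt0 : 0 < p ^ m by rewrite expn_gt0 prime_gt0.
elim: i => [|i IH] ltim; first by rewrite bin0 dvdn1 neq_ltn prime_gt1 ?orbT.
have: p %| 'C(p ^ m, i.+1).
  apply: contraLR ltim => ndvd; rewrite -leqNgt.
  have: p ^ m %| i.+1 * 'C(p ^ m, i.+1) by rewrite -mul_bin_diag dvdn_mulr.
  rewrite Gauss_dvdl; first by move/dvdn_leq; apply.
  by rewrite coprimeXl // prime_coprime.
rewrite -{1}(prednK pm_gt0) binS => dvd_add.
by apply: contra (IH (ltnW ltim)) => dvd; rewrite -(dvdn_addr _ dvd).
Qed.

(** For [j > 0], [j C(p^m, j) = p^m C(p^m - 1, j - 1)], and the last binomial is prime to [p]. *)
Lemma ndvd_bin_expn p m j : prime p -> j <= p ^ m -> ~~ (p ^ m.+1 %| 'C(p ^ m, j)).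
Proof.
move=> pr_p; case: j => [_|j ltjm].
  by rewrite bin0 dvdn1 neq_ltn -{2}(exp1n m.+1) ltn_exp2r ?prime_gt1 ?orbT.
apply: contra (prime_ndvd_bin_pred pr_p ltjm) => dvd.
rewrite -(@dvdn_pmul2l (p ^ m)) ?expn_gt0 ?prime_gt0 // -expnSr mul_bin_diag.
exact: dvdn_mull.
Qed.

(** The hypothesis excludes [s = 0], where [logn] is 0 only by convention. *)
Lemma logn_lt_ndvd p e f s : ~~ (p ^ f %| p ^ e * s) -> e + logn p s < f.
Proof.
apply: contraR; rewrite -leqNgt => le_f.
by apply: dvdn_trans (dvdn_exp2l p le_f) _; rewrite expnD dvdn_mul ?pfactor_dvdnn.
Qed.

Lemma logn3_le j : 2 <= j -> logn 3 j <= j - 2.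
Proof.
move=> j_ge2; have le3: 3 ^ logn 3 j <= j by rewrite dvdn_leq ?pfactor_dvdnn //; lia.
have: (logn 3 j).*2.+1 <= 3 ^ logn 3 j.
  by elim: (logn 3 j) => // v IH; rewrite expnS; lia.
lia.
Qed.

Local Open Scope ring_scope.

Lemma coef_X2B1_exp M j :
  (('X^2 - 1) ^+ M : {poly int})`_(j.*2) = (-1) ^+ (M - j) * ('C(M, j))%:R.
Proof.
rewrite addrC exprDn coef_sum.
have coefE i : ((-1) ^+ (M - i) * 'X^2 ^+ i *+ 'C(M, i) : {poly int})`_(j.*2)
    = if i == j then (-1) ^+ (M - i) * ('C(M, i))%:R else 0.
  rewrite coefMn -exprM mul2n -signr_odd mulr_sign.
  have -> : (i == j) = (j.*2 == i.*2) by lia.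
  rewrite -[in RHS]signr_odd.
  case: odd; rewrite ?coefN coefXn; case: eqP => // _; rewrite ?mul0rn ?oppr0 ?mul0rn //;
  by rewrite ?expr1 ?expr0 ?mulN1r ?mul1r ?mulNrn.
under eq_bigr => i _ do rewrite coefE.
have [lejM|ltMj] := leqP j M.
  by rewrite (bigD1 (inord j)) //= inordK // eqxx big1 ?addr0 // => i /eqP/val_eqP /=;
     rewrite inordK // => /negbTE ->.
rewrite bin_small // mulr0 big1 // => i _; case: eqP => // eij.
by have := ltn_ord i; lia.
Qed.

(** Put [M = 3^m]. Modulo [3^(m+1)] the polynomial is [X^M (X^2 - 1)^M], whose coefficient at
    [k = M + 2 j] is [C(M, j)] up to sign. Such a [j] exists as [k] and [M] are odd, and [k <= 3 M]
    gives [j <= M]. *)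
Lemma ndvd_coef_rising_top m k : odd k -> (3 ^ m <= k <= 3 ^ m.+1)%N ->
  ~~ (3 ^+ m.+1 %| (rising (3 ^ m.+1))`_k)%Z.
Proof.
move=> odd_k /andP[le_mk le_km]; have [c ->] := rising_eqmod m.
have odd_3m : odd (3 ^ m) by rewrite oddX orbT.
set M := (3 ^ m)%N in odd_3m le_mk *.
have kE : (M + (k - M)./2.*2 = k)%N.
  have := odd_double_half (k - M); rewrite oddB // odd_k odd_3m /= add0n => ->.
  by rewrite subnKC.
set j := (k - M)./2 in kE.
have -> : 'X^3 - 'X = 'X * ('X^2 - 1) :> {poly int} by ring.
rewrite exprMn_comm; last exact: mulrC.
rewrite coefD coef_exp3M coefXnM -kE ltnNge leq_addr /= addKn coef_X2B1_exp.
rewrite rpredDr; last exact: dvdz_mulr.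
rewrite dvdzE abszMsign abszX (natz 'C(M, j)) /=.
apply: ndvd_bin_expn => //; move: kE le_km; rewrite expnS -/M; lia.
Qed.

Lemma ndvd_coef_rising m l k : odd k -> (3 ^ m <= k <= 3 ^ m.+1)%N ->
  ~~ (3 ^+ (\sum_(i < l) 3 ^ (m.+1 + i) + m.+1) %|
      3 ^+ (l * k) * (rising (3 ^ (m.+1 + l)))`_k)%Z.
Proof.
move=> odd_k k_m; have [y ->] := coef_rising_scale m.+1 l k.
(* After cancelling [3^C], the error term [3^(m+2) y] vanishes modulo [3^(m+1)]. *)
rewrite exprD dvdz_mul2l ?expf_neq0 // rpredDr; last first.
  by rewrite exprS mulrAC dvdz_mull.
rewrite dvdzE abszM absz_sign mul1n -dvdzE; exact: ndvd_coef_rising_top.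
Qed.

(** A lower bound on valuations, for the tail of the reflection identity and for the exact value at
    [k = 1]. *)
Lemma dvd_coef_rising n l k :
  (3 ^+ (\sum_(i < l) 3 ^ (n + i)) %| 3 ^+ (l * k) * (rising (3 ^ (n + l)))`_k)%Z.
Proof. by have [y ->] := coef_rising_scale n l k; rewrite dvdz_mulr. Qed.

End Valuations.

(** * Reflection symmetry, relating even indices to odd ones *)

Section Reflection.
Local Open Scope ring_scope.

(** The factor [X] is left out because the roots [-1, ..., -(N-1)] alone are permuted by
    [X -> - X - N]. *)
Definition rising_pred N : {poly int} := \prod_(1 <= i < N) ('X + i%:R).

Lemma coef_rising_pred N a : (0 < N)%N -> (rising_pred N)`_a = (rising N)`_a.+1.
Proof.
by move=> N_gt0; rewrite /rising big_ltn // addr0 coefXM.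
Qed.

Lemma rising_pred_reflect N : odd N ->
  rising_pred N = rising_pred N \Po (- ('X + N%:R)).
Proof.
move=> odd_N; rewrite /rising_pred rmorph_prod /= big_nat_rev /=.
have -> : \prod_(1 <= i < N) (('X + i%:R) \Po - ('X + N%:R)) =
    \prod_(1 <= i < N) (-1 * ('X + (1 + N - i.+1)%:R)) :> {poly int}.
  apply: eq_big_nat => i /andP[i_gt0 ltiN].
  rewrite comp_polyXDn add1n subSS natrB ?(ltnW ltiN) //; ring.
by rewrite big_split /= prodr_const_nat -signr_odd oddB ?odd_gt0 // odd_N /= mul1r.
Qed.

Lemma coef_XDn_exp N i a : (('X + N%:R) ^+ i : {poly int})`_a = (N ^ (i - a) * 'C(i, a))%:R.
Proof.
rewrite addrC exprDn coef_sum.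
under eq_bigr => b _ do rewrite coefMn -natrX mulr_natl coefMn coefXn.
have [leai|ltia] := leqP a i.
  rewrite (bigD1 (inord a)) //= inordK // eqxx big1 ?addr0 => [|b /eqP/val_eqP /=].
    by rewrite -mulrnA.
  by rewrite inordK // eq_sym => /negbTE ->; rewrite !mul0rn.
rewrite bin_small // muln0 big1 // => b _; case: eqP => [eab|_]; last by rewrite !mul0rn.
by have := ltn_ord b; lia.
Qed.

(* Comparing coefficients of [X^a] in [rising_pred_reflect]: for odd [a] the term of
   index [a] on the right is the opposite of the left-hand side. *)
Lemma rising_pred_recur N a : odd N -> odd a -> exists L,
  2 * (rising_pred N)`_a = (N * a.+1)%:R * (rising_pred N)`_a.+1
  + \sum_(i < L) (rising_pred N)`_(a + i.+2)
       * ((-1) ^+ (a + i.+2) * (N ^ i.+2 * 'C(a + i.+2, a))%:R).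
Proof.
move=> odd_N odd_a; set Q := rising_pred N.
pose E i := Q`_i * ((-1) ^+ i * (N ^ (i - a) * 'C(i, a))%:R).
have expand : Q`_a = \sum_(i < size Q) E i.
  rewrite {1}/Q rising_pred_reflect // coef_comp_poly; apply: eq_bigr => i _.
  rewrite exprNn /E; congr (_ * _).
  rewrite -signr_odd -[in RHS]signr_odd -coef_XDn_exp.
  by case: odd; rewrite ?expr1 ?expr0 ?mulN1r ?mul1r ?coefN.
exists (size Q).
(* Padding with zero terms beyond the degree allows splitting off the indices below [a] (where the
   binomial is 0), [a] and [a.+1]. *)
have {expand} : Q`_a = \sum_(i < a.+2 + size Q) E i.
  rewrite expand (big_ord_widen _ E (leq_addl a.+2 _)) big_mkcond /=.
  apply: eq_bigr => i _; case: ltnP => // /leq_sizeP le.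
  by rewrite /E le ?mul0r.
rewrite big_split_ord 2!big_ord_recr /= big1 => [|i _]; last first.
  by rewrite /E bin_small ?muln0 ?mulr0.
rewrite add0r {1 2}/E subnn subSnn !binSn ?bin1 binn exprS -signr_odd odd_a /=.
under eq_bigr => i _ do rewrite /E addSnnS addSnnS addKn.
set T := \sum_(i < _) _ => e.
by rewrite mulrDl mul1r {1}e natrM; ring.
Qed.

End Reflection.

(** * Valuation bounds for odd and even indices *)

Section StirlingValuations.
Local Open Scope ring_scope.

Lemma logn_stirling1_odd m l k : odd k -> (3 ^ m <= k <= 3 ^ m.+1)%N ->
  (l * k + logn 3 (stirling1 (3 ^ (m.+1 + l)) k) <= \sum_(i < l) 3 ^ (m.+1 + i) + m)%N.
Proof.
move=> odd_k k_m; rewrite -ltnS -[X in (_ < X)%N]addnS; apply: logn_lt_ndvd.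
by have := ndvd_coef_rising l odd_k k_m; rewrite -stirling1_coef natz dvdzE abszM !abszX.
Qed.

(** Since [(j+2) C(a+j+2, j+2) = 2 t C(a+j+2, j+1)], the binomial loses at most [v_3(j+2) <= j]
    against [v_3(t)], which [3^j] repays. *)
Lemma dvd_tail_bin t a j : (0 < t)%N -> a.+1 = t.*2 ->
  (3 ^ logn 3 t %| 3 ^ j * 'C(a + j.+2, a))%N.
Proof.
move=> t_gt0 a1; rewrite pfactor_dvdn // ?muln_gt0 ?expn_gt0 ?bin_gt0 ?leq_addr //.
rewrite lognM ?expn_gt0 ?bin_gt0 ?leq_addr // pfactorK //.
have := congr1 (logn 3) (mul_bin_left (a + j.+2) j.+1).
have -> : (a + j.+2 - j.+1 = 2 * t)%N by lia.
have C1_gt0 : (0 < 'C(a + j.+2, j.+2))%N by rewrite bin_gt0 leq_addl.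
have C2_gt0 : (0 < 'C(a + j.+2, j.+1))%N by rewrite bin_gt0 ltnW // leq_addl.
rewrite !lognM ?muln_gt0 // -(bin_sub (leq_addl _ _)) addnK.
have -> : logn 3 2 = 0%N by [].
have := @logn3_le j.+2 isT; lia.
Qed.

(** With [n = m+1+l], the exponent [n (j+2)] splits as [l (j+1)], which completes the scaling of
    [X], plus [m+1+n], plus [j] for the binomial, plus a surplus [m j]. *)
Lemma dvd_tail_term m l t a j C X : (0 < t)%N -> a.+1 = t.*2 ->
  (3 ^ C %| 3 ^ (l * (a + j.+2).+1) * X)%N ->
  (3 ^ (C + m + (m.+1 + l) + logn 3 t).+1 %|
     3 ^ (l * t.*2.+1) * (X * ((3 ^ (m.+1 + l)) ^ j.+2 * 'C(a + j.+2, a))))%N.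
Proof.
move=> t_gt0 a1 dvdX; have dvdB := dvd_tail_bin j t_gt0 a1.
have kE : (a + j.+2).+1 = (t.*2.+1 + j.+1)%N by rewrite -a1; lia.
rewrite {}kE in dvdX.
have -> : (3 ^ (l * t.*2.+1) * (X * ((3 ^ (m.+1 + l)) ^ j.+2 * 'C(a + j.+2, a))) =
   (3 ^ (l * (t.*2.+1 + j.+1)) * X) * 3 ^ (m.+1 + (m.+1 + l))
   * (3 ^ j * 'C(a + j.+2, a)) * 3 ^ (m * j))%N.
  have -> : ((3 ^ (m.+1 + l)) ^ j.+2 =
     3 ^ (l * j.+1) * 3 ^ (m.+1 + (m.+1 + l)) * 3 ^ j * 3 ^ (m * j))%N.
    by rewrite -expnM -!expnD; congr expn; lia.
  by rewrite mulnDr !expnD; ring.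
have -> : (C + m + (m.+1 + l) + logn 3 t).+1 =
  (C + (m.+1 + (m.+1 + l)) + logn 3 t)%N by lia.
by rewrite dvdn_mulr // !expnD -expnD !dvdn_mul.
Qed.

(** In the recurrence at [a = 2 t - 1] the tail is divisible by too high a power of 3 to matter, so
    [2 s(N, 2 t)] is governed by [2 t N s(N, 2 t + 1)], whose last factor has odd index. *)
Lemma logn_stirling1_even m l t : (0 < t)%N ->
  (3 ^ m <= t.*2.+1 <= 3 ^ m.+1)%N ->
  (l * t.*2.+1 + logn 3 (stirling1 (3 ^ (m.+1 + l)) t.*2)
   <= \sum_(i < l) 3 ^ (m.+1 + i) + m + (m.+1 + l) + logn 3 t)%N.
Proof.
move=> t_gt0 k_m; set k := t.*2.+1 in k_m *; set n := (m.+1 + l)%N.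
set C := (\sum_(i < l) _)%N; have odd_k : odd k by rewrite /= odd_double.
have odd_N : odd (3 ^ n) by rewrite oddX orbT.
have N_gt0 : (0 < 3 ^ n)%N by rewrite expn_gt0.
rewrite -ltnS; apply: logn_lt_ndvd.
set D := (C + m + n + logn 3 t).+1.
apply: contra (ndvd_coef_rising l odd_k k_m) => dvd_t.
have a1 : t.*2.-1.+1 = t.*2 by lia.
have odd_a : odd t.*2.-1 by have := odd_double t; rewrite -a1 /= => /negbFE.
have [L] := rising_pred_recur odd_N odd_a.
set a := t.*2.-1 in a1 odd_a *.
rewrite !coef_rising_pred // a1 -/k -/n -/C => eqQ.
have {dvd_t} dvd_t : (3 ^+ D %| 3 ^+ (l * k) * (2 * (rising (3 ^ n))`_t.*2))%Z.
  rewrite mulrCA -stirling1_coef natz; apply: dvdz_mull.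
  by rewrite dvdzE abszM !abszX.
have dvd_tail : (3 ^+ D %| 3 ^+ (l * k) * (\sum_(i < L) (rising_pred (3 ^ n))`_(a + i.+2)
       * ((-1) ^+ (a + i.+2) * ((3 ^ n) ^ i.+2 * 'C(a + i.+2, a))%:R)))%Z.
  rewrite mulr_sumr; apply: rpred_sum => j _; rewrite coef_rising_pred //.
  have dQ := dvd_coef_rising m.+1 l (a + j.+2).+1; rewrite -/n -/C in dQ.
  rewrite -stirling1_coef natz in dQ *.
  rewrite dvdzE !abszM absz_sign mul1n !abszX (natz (_ ^ _ * _)%N).
  by apply: dvd_tail_term => //; move: dQ; rewrite dvdzE abszM !abszX.
move: dvd_t; rewrite eqQ mulrDr rpredDr // -stirling1_coef !natz !dvdzE !abszM !abszX /=.
set s := stirling1 _ _.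
have -> : (C + m.+1)%N = (C + m).+1 by rewrite addnS.
rewrite {1}/D.
have [[//|t'] co_t' tE] := pfactor_coprime (isT : prime 3) t_gt0.
have -> : (3 ^ (l * k) * (3 ^ n * t.*2 * s) =
   3 ^ (n + logn 3 t) * ((t'.+1).*2 * (3 ^ (l * k) * s)))%N.
  by rewrite -!mul2n {1}tE expnD; ring.
have -> : (C + m + n + logn 3 t).+1 = (n + logn 3 t + (C + m).+1)%N by lia.
rewrite expnD dvdn_pmul2l ?expn_gt0 // Gauss_dvdr //.
by rewrite coprimeXl // -mul2n coprimeMr co_t'.
Qed.

End StirlingValuations.

(** * Comparing the bounds over all [k] *)

Lemma exp3_bracket n k : 0 < n -> 0 < k <= 3 ^ n ->
  exists m l, n = m.+1 + l /\ 3 ^ m <= k <= 3 ^ m.+1.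
Proof.
case: n => // n _ /andP[k_gt0]; elim: n => [|n IH] le_k.
  by exists 0, 0; split=> //; rewrite k_gt0.
have [/IH[m [l [-> k_m]]]|lt_k] := leqP k (3 ^ n.+1).
  by exists m, l.+1; rewrite addnS.
by exists n.+1, 0; rewrite addn0 ltnW.
Qed.

Lemma stirling1_odd_bound n k : 0 < n -> odd k -> k <= 3 ^ n ->
  exists m l, [/\ n = m.+1 + l, 3 ^ m <= k <= 3 ^ m.+1 &
    (l * k + logn 3 (stirling1 (3 ^ n) k)).*2 + 3 ^ m.+1 <= 3 ^ n + m.*2].
Proof.
move=> n_gt0 odd_k le_k.
have [|m [l [-> k_m]]] := @exp3_bracket n k n_gt0; first by rewrite odd_gt0.
exists m, l; split=> //; have := logn_stirling1_odd l odd_k k_m.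
have := sum_exp3 m.+1 l; lia.
Qed.

Lemma stirling1_even_bound n t : 0 < n -> 0 < t -> t.*2.+1 <= 3 ^ n ->
  exists m l, [/\ n = m.+1 + l, 3 ^ m <= t.*2.+1 <= 3 ^ m.+1 &
    (l * t.*2.+1 + logn 3 (stirling1 (3 ^ n) t.*2)).*2 + 3 ^ m.+1
    <= 3 ^ n + (m + n + logn 3 t).*2].
Proof.
move=> n_gt0 t_gt0 le_t; have [//|m [l [-> t_m]]] := @exp3_bracket n t.*2.+1 n_gt0.
exists m, l; split=> //; have := logn_stirling1_even l t_gt0 t_m.
have := sum_exp3 m.+1 l; lia.
Qed.

(** For [k = 1], hence [m = 0], the upper and lower bounds agree: the valuation is [C - l] with
    [l = n - 1]. *)
Lemma logn_stirling1_1 n : 0 < n ->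
  (logn 3 (stirling1 (3 ^ n) 1)).*2 + n.*2.+1 = 3 ^ n.
Proof.
case: n => // l _; have ub := @logn_stirling1_odd 0 l 1 isT isT.
have := @ndvd_coef_rising 0 l 1 isT isT; have := dvd_coef_rising 1 l 1.
have := sum_exp3 1 l; rewrite -stirling1_coef natz !dvdzE !abszM !abszX /= muln1 in ub *.
set C := \sum_(i < l) _ in ub *; rewrite add1n in ub *.
set s := stirling1 _ _ in ub *; case: (posnP s) => [->|s_gt0]; first by rewrite muln0 !dvdn0.
rewrite !pfactor_dvdn ?muln_gt0 ?expn_gt0 // lognM ?expn_gt0 // pfactorK //.
rewrite -[1 + (1 + 1)]/3 expn1; lia.
Qed.

Lemma stirling1_le_first n k : 2 < n -> 0 < k <= 3 ^ n ->
  logn 3 (stirling1 (3 ^ n) k) <= logn 3 (stirling1 (3 ^ n) 1).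
Proof.
move=> n_gt2 /andP[k_gt0 le_k]; have n_gt0 : 0 < n by lia.
have v1 := logn_stirling1_1 n_gt0.
have lin m : 6 * m + 3 <= 3 ^ m.+1 by elim: m => // m; rewrite (expnS 3 m.+1); lia.
have [odd_k|even_k] := boolP (odd k).
  have [m [l [nE _ bnd]]] := stirling1_odd_bound n_gt0 odd_k le_k.
  have := lin m; have := leq_pmulr l k_gt0; lia.
have kE : k = k./2.*2 by rewrite -[LHS]odd_double_half (negbTE even_k).
have t_gt0 : 0 < k./2 by lia.
have odd_3n : odd (3 ^ n) by rewrite oddX orbT.
(* As [3^n] is odd, the next odd index [k + 1] is still in range. *)
have lt_k : k./2.*2.+1 <= 3 ^ n.
  rewrite -kE ltn_neqAle le_k andbT; apply: contraNneq even_k => ->; exact: odd_3n.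
have [m [l [nE t_m]]] := stirling1_even_bound n_gt0 t_gt0 lt_k.
rewrite -kE; set t := k./2 in t_gt0 t_m *; set v := logn 3 (stirling1 _ k).
have le3 : 3 ^ logn 3 t <= t by rewrite dvdn_leq ?pfactor_dvdnn.
have lt_t : logn 3 t < t by apply: leq_trans le3; apply: ltn_expl.
have le_m : logn 3 t <= m by rewrite -ltnS -(@ltn_exp2l 3) //; lia.
(* It suffices that [6 m + 5 + 4 l + 2 v_3(t) <= 3^(m+1) + 2 l (2 t + 1)]; the cases are [m = 0],
   then [l > 0], then [l = 0]. *)
have := lin m.
case: m => [|m] in nE t_m le_m *; first by move: t_m; rewrite !expn1; nia.
case: l => [|l] in nE *; last first.
  have : 2 * (l.+1 * 2) + (t.*2.-1).*2 <= (l.+1 * t.*2.+1).*2 by nia.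
  lia.
(* Bracket exponent 1 with [l = 0] means [n = 2], excluded here: the inequality would need
   [11 <= 9]. *)
case: m => [|m] in nE t_m le_m *; first by lia.
have : 8 * m + 21 <= 3 ^ m.+3 by elim: (m) => // i; rewrite (expnS 3 i.+3); lia.
lia.
Qed.

Theorem theorem1p4 (n k : nat) (hn : 0 < n) (hk : 0 < k) (hkn : k <= 3 ^ n) :
  [/\ (3 <= n ->
         logn 3 (stirling1 (3 ^ n) k) <= logn 3 (stirling1 (3 ^ n) 1) /\
         ((logn 3 (stirling1 (3 ^ n) 1))%:R =
            1 / 2 * (3 ^+ n - 2 * n%:R - 1) :> rat)%R),
      (n = 2 ->
         logn 3 (stirling1 (3 ^ 2) k) <= logn 3 (stirling1 (3 ^ 2) 6) /\
         logn 3 (stirling1 (3 ^ 2) 6) = 4)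
    & (n = 1 ->
         logn 3 (stirling1 3 k) <= logn 3 (stirling1 3 2) /\
         logn 3 (stirling1 3 2) = 1)].
Proof.
split=> [n_gt2|n2|n1].
- split; first by apply: stirling1_le_first; rewrite ?hk.
  have := congr1 (fun i => i%:R : rat)%R (logn_stirling1_1 hn).
  rewrite natrX -addn1 -!muln2 !natrD !natrM => <-; by field.
- have v6 : logn 3 (stirling1 (3 ^ 2) 6) = 4 by rewrite stirling1E; vm_compute.
  split=> //; rewrite v6; have le_k : k <= 3 ^ 2 by move: hkn; rewrite n2.
  have [odd_k|even_k] := boolP (odd k).
    have [m [l [nE _ bnd]]] := @stirling1_odd_bound 2 k isT odd_k le_k.
    by case: m l nE bnd => [|[|m]] [|[|l]] //=; lia.
  have kE : k = k./2.*2 by rewrite -[LHS]odd_double_half (negbTE even_k).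
  have t_gt0 : 0 < k./2 by lia.
  have [|m [l [nE t_m]]] := @stirling1_even_bound 2 _ isT t_gt0; first by lia.
  rewrite -kE; have le3 : 3 ^ logn 3 k./2 <= k./2 by rewrite dvdn_leq ?pfactor_dvdnn.
  have lt_v : logn 3 k./2 < 2.
    by rewrite -(@ltn_exp2l 3) //; apply: leq_ltn_trans le3 _; lia.
  (* The pair [m = 1], [l = 0] gives the bound [3 + v_3(t) <= 4]; the pair [m = 0], [l = 1] forces
     [t = 1]. *)
  case: m l nE t_m => [|[|m]] [|[|l]] //=; rewrite ?expn1; last by lia.
  move=> _ t_m; have -> : k./2 = 1 by lia.
  rewrite logn1; lia.
- have v2 : logn 3 (stirling1 3 2) = 1 by rewrite stirling1E.
  split=> //; rewrite v2; have le_k : k <= 3 ^ 1 by move: hkn; rewrite n1.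
  have [odd_k|even_k] := boolP (odd k).
    have [m [l [nE _]]] := @stirling1_odd_bound 1 k isT odd_k le_k.
    by case: m l nE => [|m] [|l] //=; rewrite expn1; lia.
  have kE : k = 2 by lia.
  by rewrite kE v2.
Qed.
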